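(* Let $k\in\mathbb{Z}$ and let $\nu\in\mathbb{R}$ with $\nu\neq 0$. For every integer $n\ge 0$, as polynomials in $x$, $$HB_{n}^{(\nu,k)}(x)=(-1)^{n}\sum_{a=0}^{n}\left\{\sum_{m=0}^{n-a}\frac{(-1)^{a+m}\,m!}{(m+1)^{k}}\binom{n}{a}S_{2}(n-a,m)\right\}H_{a}^{(\nu)}(x).$$
   Context: For $k\in\mathbb{Z}$ the polylogarithm is the power series $\mathrm{Li}_k(x)=\sum_{n=1}^{\infty}\frac{x^n}{n^k}$. All generating functions below are formal power series in $t$. $S_2(n,m)$ denotes the Stirling number of the second kind. For real $\nu\neq 0$, the Hermite polynomials $H_n^{(\nu)}(x)$ of order $\nu$ are defined by $$e^{-\frac{\nu t^2}{2}}e^{xt}=\sum_{n=0}^{\infty}H_n^{(\nu)}(x)\frac{t^n}{n!}.$$ The Hermite and poly-Bernoulli mixed-type polynomials $HB_n^{(\nu,k)}(x)$ are defined by $$e^{-\frac{\nu t^2}{2}}\,\frac{\mathrm{Li}_k(1-e^{-t})}{1-e^{-t}}\,e^{xt}=\sum_{n=0}^{\infty}HB_n^{(\nu,k)}(x)\frac{t^n}{n!}.$$ *)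

(* Defs.v *)
From HB Require Import structures.
From mathcomp Require Import all_boot all_order all_algebra.

Set Implicit Arguments.
Unset Strict Implicit.
Unset Printing Implicit Defensive.

Import Order.TTheory GRing.Theory Num.Theory.
Local Open Scope ring_scope.

(* [stirling2 n m] is S_2(n, m), counted on set partitions: [partition]
   requires all blocks to be nonempty. (It precedes the import of
   classical_sets, whose notations shadow those of finset.) *)
Definition stirling2 (n m : nat) : nat :=
  #|[set P : {set {set 'I_n}} | partition P [set: 'I_n] & #|P| == m]|.

From mathcomp Require Import boolp classical_sets reals.

(* Wrapped in a record so that the product is the Cauchy product and not the
   pointwise product of functions. *)
Record fps (A : Type) := Fps { coef_fps : nat -> A }.

Notation "f `[ n ]" := (coef_fps f n)
  (at level 2, left associativity, format "f `[ n ]") : ring_scope.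

Lemma fpsP (A : Type) (f g : fps A) : (forall n, f`[n] = g`[n]) <-> f = g.
Proof.
split=> [|-> //]; case: f g => [f] [g] /= fg; congr Fps; exact/funext.
Qed.

HB.instance Definition _ (A : Type) := gen_eqMixin (fps A).
HB.instance Definition _ (A : Type) := gen_choiceMixin (fps A).

Section FpsZmod.
Variable A : zmodType.
Implicit Types f g : fps A.

Definition fps_zero : fps A := Fps (fun=> 0).
Definition fps_opp f : fps A := Fps (fun n => - f`[n]).
Definition fps_add f g : fps A := Fps (fun n => f`[n] + g`[n]).

Fact fps_addA : associative fps_add.
Proof. by move=> f g h; apply/fpsP => n /=; rewrite addrA. Qed.
Fact fps_addC : commutative fps_add.
Proof. by move=> f g; apply/fpsP => n /=; rewrite addrC. Qed.
Fact fps_add0 : left_id fps_zero fps_add.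
Proof. by move=> f; apply/fpsP => n /=; rewrite add0r. Qed.
Fact fps_addN : left_inverse fps_zero fps_opp fps_add.
Proof. by move=> f; apply/fpsP => n /=; rewrite addNr. Qed.

HB.instance Definition _ :=
  GRing.isZmodule.Build (fps A) fps_addA fps_addC fps_add0 fps_addN.

Lemma coef_fps0 n : (0 : fps A)`[n] = 0. Proof. by []. Qed.
Lemma coef_fpsN f n : (- f)`[n] = - f`[n]. Proof. by []. Qed.
Lemma coef_fpsD f g n : (f + g)`[n] = f`[n] + g`[n]. Proof. by []. Qed.
Lemma coef_fpsB f g n : (f - g)`[n] = f`[n] - g`[n]. Proof. by []. Qed.
Lemma coef_fps_sum (I : Type) (s : seq I) (P : pred I) (F : I -> fps A) n :
  (\sum_(i <- s | P i) F i)`[n] = \sum_(i <- s | P i) (F i)`[n].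
Proof. by apply: (big_morph (fun f => f`[n])). Qed.

End FpsZmod.

Section FpsRing.
Variable A : comNzRingType.
Implicit Types f g : fps A.

Definition fps_const (c : A) : fps A := Fps (fun n => if n is 0 then c else 0).
Definition fpsX : fps A := Fps (fun n => (n == 1%N)%:R).

Definition fps_mul f g : fps A :=
  Fps (fun n => \sum_(i < n.+1) f`[i] * g`[n - i]).

Let trunc n f : {poly A} := \poly_(i < n.+1) f`[i].

Let truncM n m f g :
  (m <= n)%N -> (fps_mul f g)`[m] = (trunc n f * trunc n g)`_m.
Proof.
move=> mn /=; rewrite coefM; apply: eq_bigr => i _; rewrite !coef_poly.
by rewrite !ltnS (leq_trans (leq_ord i) mn) (leq_trans (leq_subr _ _) mn).
Qed.

Fact fps_mulC : commutative fps_mul.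
Proof. by move=> f g; apply/fpsP => n; rewrite !(truncM _ _ (leqnn n)) mulrC. Qed.

Fact fps_mulA : associative fps_mul.
Proof.
move=> f g h; apply/fpsP => n.
transitivity ((trunc n f * (trunc n g * trunc n h))`_n).
  rewrite coefM; apply: eq_bigr => i _; rewrite -(truncM _ _ (leq_subr _ _)).
  by rewrite coef_poly ltn_ord.
rewrite mulrA coefM; apply: eq_bigr => i _; rewrite -(truncM _ _ (leq_ord i)).
by rewrite coef_poly ltnS leq_subr.
Qed.

Fact fps_mul1 : left_id (fps_const 1) fps_mul.
Proof.
move=> f; apply/fpsP => n /=; rewrite big_ord_recl subn0 mul1r.
by rewrite big1 ?addr0 // => i _; rewrite mul0r.
Qed.

Fact fps_mulDl : left_distributive fps_mul +%R.
Proof.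
move=> f g h; apply/fpsP => n /=; rewrite -big_split /=.
by apply: eq_bigr => i _; rewrite mulrDl.
Qed.

Fact fps_1neq0 : fps_const 1 != 0 :> fps A.
Proof. by apply/eqP => /fpsP /(_ 0%N) /eqP; rewrite /= oner_eq0. Qed.

HB.instance Definition _ := GRing.Zmodule_isComNzRing.Build (fps A)
  fps_mulA fps_mulC fps_mul1 fps_mulDl fps_1neq0.

Lemma coef_fps1 n : (1 : fps A)`[n] = (n == 0%N)%:R.
Proof. by case: n. Qed.
Lemma coef_fpsM f g n : (f * g)`[n] = \sum_(i < n.+1) f`[i] * g`[n - i].
Proof. by []. Qed.

End FpsRing.

Arguments fpsX {A}.

(* f / g is the q with q * g = f (0 if there is none). It makes sense even
   when g is not invertible, e.g. g = 1 - e^(-t), and is unique for g != 0 over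
   an integral domain by [fps_mulIf]. *)
Definition fps_quot (A : comNzRingType) (f g : fps A) : fps A :=
  xget 0 [set q | q * g = f]%classic.

Lemma fps_quotK (A : comNzRingType) (f g : fps A) :
  (exists q, q * g = f) -> fps_quot f g * g = f.
Proof. by move=> [q qg]; apply: (@xgetPex _ 0 [set q | q * g = f]%classic); exists q. Qed.

Lemma fps_mulf_neq0 (A : idomainType) (f g : fps A) :
  f != 0 -> g != 0 -> f * g != 0.
Proof.
have ordP (h : fps A) : h != 0 ->
    exists2 i, h`[i] != 0 & forall j, (j < i)%N -> h`[j] = 0.
  move=> h0; have /ex_minnP [i hi min] : exists i, h`[i] != 0.
    apply: contrapT => nex; case/eqP: h0; apply/fpsP => i.
    by apply: contrapT => /eqP hi; apply: nex; exists i.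
  exists i => // j ji; apply/eqP; apply: contraTT ji => /min.
  by rewrite -leqNgt.
move=> /ordP [i fi fj] /ordP [j gj gi]; apply/eqP => /fpsP /(_ (i + j)%N).
have lti : (i < (i + j).+1)%N by rewrite ltnS leq_addr.
rewrite coef_fpsM (bigD1 (Ordinal lti)) //= big1 => [|k kNi].
  by rewrite addr0 addKn; apply/eqP; rewrite mulf_neq0.
case: (ltngtP k i) kNi => [ki _|ik _|ki /eqP []]; first by rewrite fj ?mul0r.
  by rewrite (gi (i + j - k)%N) ?mulr0 // ltn_subLR ?ltn_add2r // -ltnS.
exact/val_inj.
Qed.

Lemma fps_mulIf (A : idomainType) (g : fps A) :
  g != 0 -> injective (fun q => q * g).
Proof.
move=> g0 p q /eqP; rewrite -subr_eq0 -mulrBl => /eqP pq0.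
apply/eqP; rewrite -subr_eq0; apply: contra_eqT pq0 => pq.
exact: fps_mulf_neq0.
Qed.

Lemma fps_mulKf (A : idomainType) (q g : fps A) :
  g != 0 -> fps_quot (q * g) g = q.
Proof. by move=> g0; apply: (fps_mulIf g0); apply: fps_quotK; exists q. Qed.

(* f(g(t)), for g with zero constant term: g ^+ i then contributes nothing to
   the coefficient of t^n when i > n. Meaningless if g`[0] != 0. *)
Definition fps_comp (R : nzRingType) (A : comAlgType R) (f : fps R)
    (g : fps A) : fps A :=
  Fps (fun n => \sum_(i < n.+1) f`[i] *: (g ^+ i)`[n]).

Definition exp_fps (R : fieldType) : fps R := Fps (fun n => (n`!%:R)^-1).

Definition polylog_fps (R : fieldType) (k : int) : fps R :=
  Fps (fun n => if n is 0 then 0 else (n%:R ^ k)^-1).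

(* The exponential generating function: sum_n a_n t^n / n!. *)
Definition egf (R : fieldType) (V : lmodType R) (a : nat -> V) : fps V :=
  Fps (fun n => (n`!%:R)^-1 *: a n).

Definition egf_coef (R : fieldType) (V : lmodType R) (f : fps V) (n : nat) : V :=
  n`!%:R *: f`[n].

Lemma egf_coefK (R : numFieldType) (V : lmodType R) (f : fps V) :
  egf (egf_coef f) = f.
Proof.
apply/fpsP => n /=; rewrite /egf_coef scalerA mulVf ?scale1r //.
by rewrite pnatr_eq0 -lt0n fact_gt0.
Qed.

Section HermitePolyBernoulli.
Variable R : realType.

(* All series below are in R[x][[t]]: t is [fpsX] and x is ['X]. *)
Definition fps_exp (f : fps {poly R}) : fps {poly R} := fps_comp (exp_fps R) f.

Definition fps_polylog (k : int) (f : fps {poly R}) : fps {poly R} :=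
  fps_comp (polylog_fps R k) f.

Definition hermite_gf (nu : R) : fps {poly R} :=
  fps_exp (fps_const (- (nu / 2))%:P * fpsX ^+ 2)
  * fps_exp (fps_const 'X * fpsX).

Definition hermite (nu : R) : nat -> {poly R} := egf_coef (hermite_gf nu).

Definition hermite_polyBernoulli_gf (nu : R) (k : int) : fps {poly R} :=
  let u := 1 - fps_exp (- fpsX) in
  fps_exp (fps_const (- (nu / 2))%:P * fpsX ^+ 2)
  * fps_quot (fps_polylog k u) u
  * fps_exp (fps_const 'X * fpsX).

Definition hermite_polyBernoulli (nu : R) (k : int) : nat -> {poly R} :=
  egf_coef (hermite_polyBernoulli_gf nu k).

End HermitePolyBernoulli.

(* Main.v *)
Require Import Defs.
From HB Require Import structures.
From mathcomp Require Import all_boot all_order all_algebra.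

(** Put u = 1 - e^(-t). The generating function of the mixed-type polynomials
is that of the Hermite polynomials times Li_k(u) / u, and a product of
exponential generating functions is the binomial convolution of their
sequences ([egfM]). So the whole content is the expansion of Li_k(u) / u, the
generating function of the poly-Bernoulli numbers ([fps_quot_polylog]).

Cancelling one factor u from the polylogarithm gives
Li_k(u) / u = sum_m u^m / (m+1)^k ([fps_comp_divX]), and
u^m = (-1)^m (e^(-t) - 1)^m, so it remains to know that (e^(ct) - 1)^m is the
exponential generating function of m! S_2(n,m) c^n ([egf_expB1X]).

Since S_2 counts set partitions, this last fact needs a combinatorial input.
Classifying the m^n maps from an n-set to an m-set by the partition into their
fibres gives m^n = sum_i S_2(n,i) i! C(m,i) ([expn_stirling2]). On the other
hand e^(mct) = ((e^(ct) - 1) + 1)^m = sum_i C(m,i) (e^(ct) - 1)^i. Both express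
the coefficients of e^(mct), for every m, as binomial transforms; the binomial
transform is injective ([binomial_sum_inj]), so the transformed sequences
agree. *)

Set Implicit Arguments.
Unset Strict Implicit.
Unset Printing Implicit Defensive.

Import Order.TTheory GRing.Theory Num.Theory.
Local Open Scope ring_scope.

(** * Counting maps by their fibres *)

Section Kernels.
Local Open Scope nat_scope.
Variables T U : finType.

(** Turns an equality of set partitions into an equivalence between two
relations on points, which is what one checks for a given map. *)
Lemma preim_partition_eqP (f : {ffun T -> U}) (P : {set {set T}}) :
  partition P [set: T] ->
  reflect (forall x y, (f x == f y) = (y \in pblock P x))
          (preim_partition f [set: T] == P).
Proof.
move=> partP; apply: (iffP eqP) => [kerP x y | kerP].
  rewrite -kerP pblock_equivalence_partition ?inE //.
  by split=> //= /eqP ->.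
rewrite -[RHS](equivalence_partition_pblock partP).
by apply: eq_imset => x; apply/setP => y; rewrite !inE /= kerP.
Qed.

(** A map whose fibres are the blocks of P amounts to an injective map on the
set of blocks: compose the latter with the map sending a point to its block. *)
Lemma card_ffun_preim_partition (P : {set {set T}}) :
  partition P [set: T] ->
  #|[set f : {ffun T -> U} | preim_partition f [set: T] == P]|
  = #|U| ^_ #|P|.
Proof.
move=> partP; have [/eqP covP trivP P0] := and3P partP.
have inP x : pblock P x \in P by rewrite pblock_mem // covP inE.
have neP (B : {B : {set T} | B \in P}) : exists x, x \in val B.
  by apply/set0Pn; apply: contraNneq P0 => <-; apply: valP.
pose blk x : {B | B \in P} := exist _ (pblock P x) (inP x).
pose pt B := xchoose (neP B).
have ptK : cancel pt blk.
  move=> B; apply: val_inj; apply: (def_pblock trivP (valP B)).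
  exact: xchooseP.
have eq_blk x y : (blk x == blk y) = (y \in pblock P x).
  by rewrite -val_eqE /= eq_pblock // covP inE.
pose lift (g : {ffun {B | B \in P} -> U}) := [ffun x => g (blk x)].
have lift_inj : injective lift.
  move=> g h /ffunP gh; apply/ffunP => B.
  by have := gh (pt B); rewrite !ffunE ptK.
rewrite -[#|P|]card_sig -card_inj_ffuns -(card_imset _ lift_inj).
apply: eq_card => f; rewrite !inE.
apply/(preim_partition_eqP _ partP)/imsetP => [kerP | [g]].
  exists [ffun B => f (pt B)]; last first.
    apply/ffunP => x; rewrite !ffunE; apply/eqP.
    by rewrite kerP -eq_blk ptK.
  rewrite inE; apply/injectiveP => B C; rewrite !ffunE => /eqP.
  by rewrite kerP -eq_blk !ptK => /eqP.
rewrite inE => /injectiveP g_inj -> x y.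
by rewrite !ffunE (inj_eq g_inj) eq_blk.
Qed.

End Kernels.

(** Classification of the m ^ n maps by their fibre partition, and then of the
partitions by their number of blocks. *)
Lemma expn_stirling2 m n :
  (m ^ n = \sum_(i < m.+1) stirling2 n i * m ^_ i)%N.
Proof.
rewrite -{1}[m]card_ord -{1}[n]card_ord -card_ffun -sum1_card.
pose ker (f : {ffun 'I_n -> 'I_m}) := preim_partition f [set: 'I_n].
have kerP f : partition (ker f) [set: 'I_n] by apply: preim_partitionP.
(* The falling factorial counting the maps with the same fibres as f is
   positive, since f is one of them. *)
have card_ker f : (#|ker f| < m.+1)%N.
  rewrite ltnS -ffact_gt0 -[m in (m ^_ _)%N]card_ord.
  rewrite -card_ffun_preim_partition // card_gt0.
  by apply/set0Pn; exists f; rewrite inE.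
rewrite (partition_big ker
  (fun P => partition P [set: 'I_n] && (#|P| < m.+1)%N)) => [|f _] /=; last first.
  by rewrite kerP card_ker.
rewrite (partition_big (fun P : {set {set 'I_n}} => inord #|P| : 'I_m.+1)
  predT) //=.
apply: eq_bigr => i _; rewrite /stirling2 -sum1_card big_distrl /=.
apply: eq_big => P.
  rewrite !inE -andbA; apply: andb_id2l => _; rewrite -val_eqE /=.
  have [Plt | Pge] := ltnP; first by rewrite inordK.
  by apply/esym/negbTE; apply: contraTneq Pge => ->; rewrite -ltnNge.
case/andP => /andP [partP Plt] /eqP <-; rewrite inordK //.
rewrite mul1n -[m in RHS]card_ord -card_ffun_preim_partition // -sum1_card.
by apply: eq_bigl => f; rewrite !inE.
Qed.

(** * Exponential generating functions *)

From mathcomp Require Import boolp classical_sets reals.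

(** The binomial transform is unitriangular: its m-th term is a m plus a
combination of the a i with i < m. *)
Lemma binomial_sum_inj (V : zmodType) (a b : nat -> V) :
  (forall m, \sum_(i < m.+1) a i *+ 'C(m, i)
             = \sum_(i < m.+1) b i *+ 'C(m, i)) ->
  a =1 b.
Proof.
move=> eq_ab m; elim/ltn_ind: m => m IHm.
have := eq_ab m; rewrite !big_ord_recr /= binn !mulr1n.
rewrite (eq_bigr (fun i : 'I_m => b i *+ 'C(m, i))) => [/addrI //|i _].
by rewrite IHm.
Qed.

Section Egf.
Variables (F : numFieldType) (A : comAlgType F).
Implicit Types (a b : nat -> A) (c : A).

Lemma egfM a b :
  egf a * egf b
  = egf (fun n => \sum_(i < n.+1) (a i * b (n - i)%N) *+ 'C(n, i)).
Proof.
apply/fpsP => n; rewrite coef_fpsM /= scaler_sumr; apply: eq_bigr => i _.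
rewrite -scalerAl -scalerAr scalerA -scaler_nat scalerA; congr (_ *: _).
rewrite -(@bin_fact n i) ?leq_ord // !natrM !invfM.
rewrite [_ * 'C(n, i)%:R]mulrAC mulVf ?mul1r //.
by rewrite pnatr_eq0 -lt0n bin_gt0 leq_ord.
Qed.

(** e^(ct) e^(dt) = e^((c+d)t). The series is written as a generating function,
and not as a composition with the exponential, so that the law is the binomial
theorem. *)
Lemma egf_exprD c d :
  egf (fun n => c ^+ n) * egf (fun n => d ^+ n) = egf (fun n => (c + d) ^+ n).
Proof.
rewrite egfM; congr egf; apply/funext => n.
rewrite addrC exprDn; apply: eq_bigr => i _.
by rewrite mulrC.
Qed.

Lemma egf_exprX c m :
  egf (fun n => c ^+ n) ^+ m = egf (fun n => (c *+ m) ^+ n).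
Proof.
elim: m => [|m IHm]; last by rewrite exprS IHm egf_exprD mulrS.
apply/fpsP => n; rewrite expr0 coef_fps1 /= mulr0n expr0n.
by case: n => [|n]; rewrite /= ?fact0 ?invr1 ?scale1r ?scaler0.
Qed.

Lemma coef_fpsMn (f : fps A) k n : (f *+ k)`[n] = f`[n] *+ k.
Proof. by elim: k => // k IHk; rewrite !mulrS coef_fpsD IHk. Qed.

Lemma coef_fpsNX (f : fps A) m n :
  ((- f) ^+ m)`[n] = (-1) ^+ m * (f ^+ m)`[n].
Proof.
rewrite [in LHS]exprNn; move: (f ^+ m) => g.
elim: m => [|m IHm]; first by rewrite !mul1r.
by rewrite !exprS !mulN1r !mulNr coef_fpsN IHm.
Qed.

(** For fixed n, both sides are sequences in m whose binomial transform is the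
coefficient of t^n in e^(mct): on the left by expanding
((e^(ct) - 1) + 1)^m, on the right by [expn_stirling2]. *)
Lemma egf_expB1X c m :
  (egf (fun n => c ^+ n) - 1) ^+ m
  = egf (fun n => (c ^+ n) *+ (m`! * stirling2 n m)).
Proof.
apply/fpsP => n; move: m.
apply: (@binomial_sum_inj A (fun m => ((egf (fun n => c ^+ n) - 1) ^+ m)`[n])
  (fun m => (egf (fun n => (c ^+ n) *+ (m`! * stirling2 n m)))`[n])) => m.
transitivity ((egf (fun n => c ^+ n) ^+ m)`[n]).
  rewrite -[in RHS](subrK 1 (egf _)) [in RHS]addrC exprDn coef_fps_sum.
  by apply: eq_bigr => i _; rewrite expr1n mul1r coef_fpsMn.
rewrite egf_exprX /= exprMn_n expn_stirling2 -sumrMnr scaler_sumr.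
apply: eq_bigr => i _; rewrite !scalerMnr -mulrnA; congr (_ *: (_ *+ _)).
by rewrite -bin_ffact mulnCA [RHS]mulnC [in RHS](mulnC i`!).
Qed.

End Egf.

(** * Division by the variable in a composition *)

Section Comp.
Variables (R : nzRingType) (A : comAlgType R).
Implicit Types (f : fps R) (g : fps A).

Lemma coef_fpsX_lt g i n : g`[0] = 0 -> (n < i)%N -> (g ^+ i)`[n] = 0.
Proof.
move=> g0; elim: i n => // i IHi n ni; rewrite exprS coef_fpsM big1 // => j _.
case: (posnP j) => [->|j0]; first by rewrite g0 mul0r.
rewrite IHi ?mulr0 // ltn_subLR ?leq_ord //.
by apply: leq_trans ni _; rewrite -add1n leq_add2r.
Qed.

(** Lets all coefficients of a product with a composition be summed over one
common range, so that the two sums can be exchanged. *)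
Lemma coef_fps_comp_widen f g n N : g`[0] = 0 -> (n <= N)%N ->
  (fps_comp f g)`[n] = \sum_(i < N.+1) f`[i] *: (g ^+ i)`[n].
Proof.
move=> g0 nN /=; rewrite (big_ord_widen N.+1 (fun i => f`[i] *: (g ^+ i)`[n])) //.
rewrite big_mkcond; apply: eq_bigr => i _; case: ltnP => // ni.
by rewrite coef_fpsX_lt ?scaler0.
Qed.

(** If f(t) = t h(t) then f(g(t)) = h(g(t)) g(t): this makes the quotient
f(g) / g explicit although g is not invertible. *)
Lemma fps_comp_divX f g : f`[0] = 0 -> g`[0] = 0 ->
  fps_comp f g = fps_comp (Fps (fun i => f`[i.+1])) g * g.
Proof.
move=> f0 g0; apply/fpsP => n.
rewrite (coef_fps_comp_widen _ g0 (leqnSn n)) big_ord_recl f0 scale0r add0r.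
rewrite coef_fpsM.
under [RHS]eq_bigr => j _.
  rewrite (coef_fps_comp_widen _ g0 (leq_ord j)) mulr_suml; over.
rewrite exchange_big; apply: eq_bigr => i _.
rewrite exprSr coef_fpsM scaler_sumr; apply: eq_bigr => j _.
by rewrite scalerAl.
Qed.

End Comp.

(** * Poly-Bernoulli numbers *)

Section Application.
Variable R : realType.

Lemma fps_exp_opp_X :
  fps_exp (- fpsX : fps {poly R}) = egf (fun n => (-1) ^+ n).
Proof.
have expNX i n : ((- fpsX : fps {poly R}) ^+ i)`[n] = (-1) ^+ i * (n == i)%:R.
  elim: i n => [|i IHi] n; first by rewrite coef_fps1 mul1r.
  rewrite exprS mulNr coef_fpsN coef_fpsM exprS mulN1r mulNr; congr (- _).
  case: n => [|n]; first by rewrite big_ord1 mul0r mulr0.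
  rewrite big_ord_recl mul0r add0r big_ord_recl mul1r subn1 IHi.
  by rewrite big1 ?addr0 // => j _; rewrite mul0r.
apply/fpsP => n; rewrite /= big_ord_recr /= big1 => [|i _]; last first.
  by rewrite expNX gtn_eqF ?mulr0 ?scaler0.
by rewrite add0r expNX eqxx mulr1.
Qed.

(** The exponential coefficients of Li_k(u) / u are the poly-Bernoulli numbers,
read off from sum_m u^m / (m+1)^k and
u^m = (-1)^m (e^(-t) - 1)^m. They are constant polynomials in x. *)
Lemma fps_quot_polylog (k : int) :
  let u : fps {poly R} := 1 - fps_exp (- fpsX) in
  fps_quot (fps_polylog k u) u
  = egf (fun n => (\sum_(m < n.+1) (-1) ^+ (n + m) * m`!%:R / m.+1%:R ^ k
                     * (stirling2 n m)%:R)%:P).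
Proof.
move=> u; rewrite /fps_polylog.
have uE : u = - (egf (fun n => (-1) ^+ n) - 1) by rewrite opprB -fps_exp_opp_X.
have u0 : u`[0] = 0 by rewrite uE /= fact0 invr1 scale1r subrr oppr0.
have u_neq0 : u != 0.
  apply/eqP => /fpsP /(_ 1%N) /eqP.
  by rewrite uE /= invr1 scale1r expr1 subr0 opprK oner_eq0.
rewrite fps_comp_divX // fps_mulKf //; apply/fpsP => n /=.
rewrite raddf_sum scaler_sumr; apply: eq_bigr => m _.
(* Every factor is a constant polynomial: the identity is one between
   scalars. *)
have signP i : (-1) ^+ i = ((-1) ^+ i)%:P :> {poly R}.
  by rewrite polyC_exp polyCN.
rewrite uE coef_fpsNX egf_expB1X /= !signP -polyCMn -!mul_polyC -!polyCM.
congr polyC; rewrite exprD -[_ *+ (_ * _)]mulr_natr natrM.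
rewrite [_ ^+ m * (_ * _)]mulrCA [LHS]mulrCA; congr (_ * _).
by rewrite mulrC -!mulrA mulrCA [X in _ = _ * (_ * (_ * X))]mulrC.
Qed.

End Application.

Theorem theorem4 (R : realType) (k : int) (nu : R) (hnu : nu != 0) (n : nat) :
  hermite_polyBernoulli nu k n =
  (-1) ^+ n *: \sum_(0 <= a < n.+1)
    (\sum_(0 <= m < (n - a).+1)
       (-1) ^+ (a + m) * m`!%:R / (m.+1%:R ^ k)
       * 'C(n, a)%:R * (stirling2 (n - a) m)%:R) *: hermite nu a.
Proof.
rewrite /hermite_polyBernoulli /hermite_polyBernoulli_gf /= mulrAC.
rewrite -[_ * fps_exp _]/(hermite_gf nu) -[hermite_gf nu]egf_coefK.
rewrite fps_quot_polylog egfM /egf_coef /= scalerA mulfV; last first.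
  by rewrite pnatr_eq0 -lt0n fact_gt0.
rewrite scale1r big_mkord scaler_sumr; apply: eq_bigr => a _.
rewrite big_mkord scalerA mulr_sumr mulrC mul_polyC -scaler_nat scalerA mulr_sumr.
congr (_ *: _); apply: eq_bigr => m _.
(* The exponents n - a + m and n + (a + m) have the same parity. *)
have -> : (-1) ^+ (n - a + m) = (-1) ^+ n * (-1) ^+ (a + m) :> R.
  by rewrite -exprD -signr_odd -[RHS]signr_odd !oddD oddB ?leq_ord // addbA.
by rewrite mulrC -!mulrA [_ * 'C(n, a)%:R]mulrC.
Qed.
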